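(* There is an absolute constant $K_2>0$ such that the following holds. Let $r=r(n)$ satisfy $r \geq K_2 (\log n/n)^{1/5}$ and let $G \in \mathcal{G}(n,r)$. Then $c(G) = 1$ with probability tending to $1$ as $n\to\infty$.
   Context: $\mathcal{G}(n,r)$ denotes the random geometric graph $G(x_1,\dots,x_n;r)$ where $x_1,\dots,x_n$ are chosen independently and uniformly at random from $[0,1]^2$, and $x_i,x_j$ ($i\ne j$) are adjacent iff $\|x_i-x_j\|\le r$. Game of cops and robbers on a finite graph: cops choose starting vertices, then the robber; players alternate turns, each agent moving to an adjacent vertex or staying put (cops move simultaneously; full information); cops win if some cop eventually occupies the robber's vertex. The cop number $c(G)$ is the minimum number of cops having a strategy that wins against every robber strategy. *)

(* Defs.v *)
From Stdlib Require Import Reals List.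
Import ListNotations.
Open Scope R_scope.

(** * Random geometric graph on a configuration of n points in R^2.
    A configuration is encoded by a coordinate vector x : nat -> R; point i
    (for i < n) is (x (2i), x (2i+1)). Vertices are 0 .. n-1. *)
Definition ptx (x : nat -> R) (i : nat) : R := x (2 * i)%nat.
Definition pty (x : nat -> R) (i : nat) : R := x (2 * i + 1)%nat.

Definition dist2 (x : nat -> R) (i j : nat) : R :=
  sqrt ((ptx x i - ptx x j) ^ 2 + (pty x i - pty x j) ^ 2).

Definition rgg_adj (n : nat) (x : nat -> R) (r : R) (i j : nat) : Prop :=
  (i < n)%nat /\ (j < n)%nat /\ i <> j /\ dist2 x i j <= r.

Section Game.
Variable n : nat.
Variable adj : nat -> nat -> Prop.

(** a state: positions of the cops (cop i, i < k, at C i) and robber position *)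
Definition state : Type := ((nat -> nat) * nat)%type.

Definition step (u v : nat) : Prop := v = u \/ adj u v.

Record cop_strategy := {
  cs_init : nat -> nat;
  cs_move : list state -> nat -> nat   (* move, given the full history *)
}.
Record robber_strategy := {
  rs_init : (nat -> nat) -> nat;               (* placement, seeing the cops *)
  rs_move : list state -> (nat -> nat) -> nat  (* move, given history and the
                                                  cops' new positions *)
}.

Definition cop_legal (k : nat) (cs : cop_strategy) : Prop :=
  (forall i, (i < k)%nat -> (cs_init cs i < n)%nat) /\
  (forall (h : list state) (C : nat -> nat) (R : nat), 
     forall i, (i < k)%nat -> step (C i) (cs_move cs ((C, R) :: h) i)).

Definition robber_legal (rs : robber_strategy) : Prop :=
  (forall C, (rs_init rs C < n)%nat) /\
  (forall (h : list state) (C : nat -> nat) (R : nat) (C' : nat -> nat),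
     step R (rs_move rs ((C, R) :: h) C')).

(** history after t rounds, most recent state first *)
Fixpoint history (cs : cop_strategy) (rs : robber_strategy) (t : nat) : list state :=
  match t with
  | O => [(cs_init cs, rs_init rs (cs_init cs))]
  | S t' => let h := history cs rs t' in
            let C' := cs_move cs h in
            (C', rs_move rs h C') :: h
  end.

Definition cur (cs : cop_strategy) (rs : robber_strategy) (t : nat) : state :=
  hd (cs_init cs, O) (history cs rs t).

(** the cops win the play if at some moment some cop occupies the robber's
    vertex: either after the robber's move (state at time t) or right after
    the cops' move of round t+1 (before the robber answers). *)
Definition cops_capture (k : nat) (cs : cop_strategy) (rs : robber_strategy) : Prop :=
  exists t i, (i < k)%nat /\
    (fst (cur cs rs t) i = snd (cur cs rs t) \/
     cs_move cs (history cs rs t) i = snd (cur cs rs t)).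

Definition cops_win (k : nat) : Prop :=
  exists cs, cop_legal k cs /\
    forall rs, robber_legal rs -> cops_capture k cs rs.

(** c(G) = 1: one cop suffices, zero cops do not (cops_win is monotone in k,
    so this says the minimum is exactly 1). *)
Definition cop_number_one : Prop := cops_win 1 /\ ~ cops_win 0.
End Game.

(** * Lebesgue outer measure on R^d (via countable covers by closed boxes).
    outer_measure_le d S eps : the Lebesgue outer measure of
    { (x_0..x_{d-1}) | S x } is at most eps. *)
Fixpoint box_vol (d : nat) (a b : nat -> R) : R :=
  match d with
  | O => 1
  | S d' => box_vol d' a b * (b d' - a d')
  end.

Definition in_box (d : nat) (a b x : nat -> R) : Prop :=
  forall k, (k < d)%nat -> a k <= x k <= b k.

Fixpoint sum_to (m : nat) (f : nat -> R) : R :=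
  match m with O => 0 | S m' => sum_to m' f + f m' end.

Definition outer_measure_le (d : nat) (S : (nat -> R) -> Prop) (eps : R) : Prop :=
  exists A B : nat -> nat -> R,
    (forall j k, A j k <= B j k) /\
    (forall x, S x -> exists j, in_box d (A j) (B j) x) /\
    (forall m, sum_to m (fun j => box_vol d (A j) (B j)) <= eps).

Definition in_unit_cube (d : nat) (x : nat -> R) : Prop :=
  forall k, (k < d)%nat -> 0 <= x k <= 1.

(** the "bad" event for G(n,r): configurations in [0,1]^{2n} whose
    random geometric graph does not have cop number 1. Since the law of
    (x_1..x_n) is Lebesgue measure on [0,1]^{2n}, the probability of the
    bad event is the Lebesgue measure of this set. *)
Definition bad_event (n : nat) (r : R) (x : nat -> R) : Prop :=
  in_unit_cube (2 * n) x /\ ~ cop_number_one n (rgg_adj n x r).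

(* Main.v *)
Require Import Defs.
From Stdlib Require Import Reals List Lia Lra Psatz Arith ZArith.
From Stdlib Require Import Classical ClassicalEpsilon FinFun.
Import ListNotations.
Open Scope R_scope.

(** Order the vertices by their distance to the centre [O] of the square. Among
    the vertices no farther from [O] than [v], all neighbours of [v] are
    neighbours of any [u] obtained from [v] by a step of length between
    [r^2/8] and [r^2/4] towards [O] with a sideways error of order [r^3]. These
    [u] fill a region of area of order [r^5 >= K log n / n], so with high
    probability every [v] with [|v| > r/2] is dominated in this way, while the
    vertices with [|v| <= r/2] form a clique. Hence the graph is dismantlable
    and one cop wins by chasing the shadows of the robber under the successive
    retractions.

    For the probability, the square is cut into cells of side [h] of order
    [r^3]. The segment of admissible [u] meets about [r^2 / h] distinct cells;
    all points avoid them with probability at most [exp (- c n r^5)], and a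
    union bound is taken over the [h^-2] cells that may contain [v]. *)

(** * Dismantling and the cop's strategy *)

Lemma least_nat (P : nat -> Prop) (m : nat) :
  P m -> exists i, P i /\ forall j, P j -> (i <= j)%nat.
Proof.
  induction m as [m IH] using (well_founded_induction lt_wf); intros Hm.
  destruct (classic (exists j, P j /\ (j < m)%nat)) as [[j [Hj Hlt]]|Hno].
  - exact (IH j Hlt Hj).
  - exists m; split; [exact Hm|]. intros j Hj.
    destruct (le_lt_dec m j) as [|Hlt]; [assumption|]. exfalso; eauto.
Qed.

Section Game.
Variable n : nat.
Variable adj : nat -> nat -> Prop.
Hypothesis adj_dom : forall u v, adj u v -> (u < n)%nat /\ (v < n)%nat.

(** With [k = 0] no index can witness a capture, so it is enough that some legal robber exists; the
    one that stays at vertex [0] does. *)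
Lemma not_cops_win_0 : (1 <= n)%nat -> ~ cops_win n adj 0.
Proof.
  intros Hn [cs [_ H]].
  destruct (H {| rs_init := fun _ => O;
                 rs_move := fun h _ => snd (hd (fun _ => O, O) h) |})
    as [t [i [Hi _]]]; [|lia].
  split; simpl; [intros; lia|]. intros; now left.
Qed.

Section Strategy.
Variable F : nat -> nat -> nat.
Variable k c0 : nat.

(* The cop aims at the shadow [F i R] of the robber with the smallest index
   [i] reachable in one move; [F_cross] makes this index drop every round. *)
Definition aim (c R m : nat) : Prop :=
  exists i, m = F i R /\ step adj c m /\
    forall j, step adj c (F j R) -> (i <= j)%nat.

(** The fallback [c] keeps the move legal in positions where no shadow is within reach. *)
Definition shadow_move (c R : nat) : nat :=
  match excluded_middle_informative (exists m, aim c R m) with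
  | left H => proj1_sig (constructive_indefinite_description _ H)
  | right _ => c
  end.

Definition shadow_strategy : cop_strategy :=
  {| cs_init := fun _ => c0;
     cs_move := fun h i =>
       match h with
       | [] => c0
       | (C, R) :: _ => shadow_move (C i) R
       end |}.

Lemma shadow_move_step c R : step adj c (shadow_move c R).
Proof.
  unfold shadow_move.
  destruct (excluded_middle_informative _) as [H|_]; [|now left].
  destruct (constructive_indefinite_description _ H) as [m Hm]; simpl.
  now destruct Hm as [i [_ [Hm _]]].
Qed.

Lemma shadow_move_aims c R i :
  step adj c (F i R) ->
  exists j, (j <= i)%nat /\ shadow_move c R = F j R.
Proof.
  intros Hi.
  assert (H : exists m, aim c R m).
  { destruct (least_nat (fun i => step adj c (F i R)) i Hi) as [j [Hj Hmin]].
    exists (F j R), j. auto. }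
  unfold shadow_move.
  destruct (excluded_middle_informative _) as [H'|H']; [|contradiction].
  destruct (constructive_indefinite_description _ H') as [m Hm]; simpl.
  destruct Hm as [j [-> [_ Hmin]]]. exists j. auto.
Qed.

Hypothesis F_0 : forall R, (R < n)%nat -> F 0 R = R.
Hypothesis F_cross : forall i R R', (i < k)%nat -> (R < n)%nat ->
  step adj R R' -> step adj (F (S i) R) (F i R').
Hypothesis F_last : forall R, (R < n)%nat -> step adj c0 (F k R).
Hypothesis c0_dom : (c0 < n)%nat.

(** Strong induction on the level [i] of a shadow within reach. The cop moves to [F j R] with
    [j <= i]. If [j = 0] this is the robber's vertex; otherwise [F_cross] puts [F (j - 1) R'] within
    reach, wherever the robber goes. *)
Lemma cops_win_of_shadows : cops_win n adj 1.
Proof.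
  exists shadow_strategy. split.
  { split; simpl; [auto|]. intros. apply shadow_move_step. }
  intros rs [Hinit Hmove].
  (* A nonempty history rules out the default branch of the strategy, and [R < n] makes the
     hypotheses on [F] applicable. *)
  assert (Hrob : forall t, exists C R h,
      history shadow_strategy rs t = (C, R) :: h /\ (R < n)%nat).
  { induction t as [|t [C [R [h [E HR]]]]]; simpl.
    - eexists _, _, _; split; [reflexivity|]. apply Hinit.
    - eexists _, _, _; split; [reflexivity|]. rewrite E.
      destruct (Hmove h C R (fun i => shadow_move (C i) R)) as [->|Hadj]; auto.
      apply (adj_dom _ _ Hadj). }
  assert (Hind : forall i t, (i <= k)%nat ->
      step adj (fst (cur shadow_strategy rs t) 0%nat)
               (F i (snd (cur shadow_strategy rs t))) ->
      cops_capture 1 shadow_strategy rs).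
  { induction i as [i IH] using (well_founded_induction lt_wf).
    intros t Hik Hst.
    destruct (Hrob t) as [C [R [h [E HR]]]].
    unfold cur in Hst; rewrite E in Hst; simpl in Hst.
    destruct (shadow_move_aims _ _ _ Hst) as [j [Hj Haim]].
    destruct j as [|j].
    - exists t, O. split; [lia|]. right. unfold cur. rewrite E. simpl.
      rewrite Haim. auto.
    - apply (IH j ltac:(lia) (S t)); [lia|].
      unfold cur; simpl. rewrite E; simpl. rewrite Haim.
      apply F_cross; [lia|assumption|]. apply Hmove. }
  apply (Hind k O (le_n k)). unfold cur; simpl. apply F_last, Hinit.
Qed.
End Strategy.

(** The hypotheses of the chase, restricted to a robber confined to [L], so that vertices can be
    deleted one at a time. In the construction below [F i] is the composite of the first [i]
    retractions. *)
Definition shadows_on (L : list nat) : Prop :=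
  exists (F : nat -> nat -> nat) (k c0 : nat),
    In c0 L /\
    (forall R, In R L -> F 0%nat R = R) /\
    (forall i R R', (i < k)%nat -> In R L -> In R' L ->
       step adj R R' -> step adj (F (S i) R) (F i R')) /\
    (forall R, In R L -> step adj c0 (F k R)).

(** Domination makes the map [f] sending [v] to [u] a retraction of [L] onto [L'] that preserves
    [step]. Applying [f] before the shadows on [L'] shifts their levels by one and frees level [0]
    for the identity. *)
Lemma shadows_on_dominated (L L' : list nat) (u v : nat) :
  (forall u v, adj u v -> adj v u) ->
  (forall w, In w L <-> w = v \/ In w L') ->
  ~ In v L' -> In u L' ->
  (forall w, In w L -> step adj v w -> step adj u w) ->
  shadows_on L' -> shadows_on L.
Proof.
  intros Hsym HL Hv Hu Hdom [F [k [c0 [Hc0 [HF0 [HFS HFk]]]]]].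
  set (f := fun w => if Nat.eq_dec w v then u else w).
  assert (Hf : forall w, In w L -> In (f w) L').
  { intros w Hw. unfold f. destruct (Nat.eq_dec w v); auto.
    apply HL in Hw. tauto. }
  exists (fun i => match i with O => fun w => w | S j => fun w => F j (f w) end),
    (S k), c0.
  assert (Hss : forall a b, step adj a b -> step adj b a).
  { intros a b [->|H]; [now left|right; auto]. }
  split; [apply HL; auto|]. split; [auto|]. split; [|auto].
  intros [|i] R R' Hi HR HR' Hst; simpl.
  - rewrite HF0 by auto. unfold f.
    destruct (Nat.eq_dec R v) as [->|]; auto.
  - apply HFS; auto; [lia|]. unfold f.
    destruct (Nat.eq_dec R v) as [->|]; destruct (Nat.eq_dec R' v) as [->|]; auto.
    now left.
Qed.

Lemma list_max_exists (g : nat -> R) (L : list nat) :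
  L <> [] -> exists v, In v L /\ forall w, In w L -> g w <= g v.
Proof.
  induction L as [|a L IH]; [easy|intros _].
  destruct L as [|b L].
  - exists a; split; [now left|]. intros w [->|[]]; lra.
  - destruct IH as [v [Hv Hm]]; [easy|].
    destruct (Rle_dec (g a) (g v)).
    + exists v; split; [now right|]. intros w [<-|Hw]; auto.
    + exists a; split; [now left|]. intros w [<-|Hw]; [lra|].
      apply Hm in Hw. lra.
Qed.

Variable g : nat -> R.
Variable rho : R.
Hypothesis adj_sym : forall u v, adj u v -> adj v u.
Hypothesis core_complete : forall u v, (u < n)%nat -> (v < n)%nat ->
  g u <= rho -> g v <= rho -> step adj u v.
Hypothesis dominated : forall v, (v < n)%nat -> rho < g v ->
  exists u, (u < n)%nat /\ g u < g v /\
    forall w, (w < n)%nat -> g w <= g v -> step adj v w -> step adj u w.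

(** Vertices are deleted in decreasing order of [g]. A [g]-maximal [v] in [L] beyond [rho] has a
    dominating [u] with smaller [g], which lies in [L] because [L] is closed downwards; maximality
    of [v] preserves this closure after the deletion. *)
Lemma shadows_on_lower_set (m : nat) (L : list nat) :
  (length L <= m)%nat -> L <> [] ->
  (forall v, In v L -> (v < n)%nat) ->
  (forall u v, In v L -> (u < n)%nat -> g u < g v -> In u L) ->
  shadows_on L.
Proof.
  revert L; induction m as [|m IH]; intros L Hlen Hne Hdom Hlow.
  { destruct L; [easy|simpl in Hlen; lia]. }
  destruct (list_max_exists g L Hne) as [v [Hv Hmax]].
  destruct (Rle_lt_dec (g v) rho) as [Hcore|Hout].
  (* All of [L] lies in the core, a clique: no retraction is left, and any vertex serves as [c0]. *)
  - exists (fun _ w => w), O, v.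
    split; [exact Hv|]. split; [auto|]. split; [intros; lia|].
    intros R HR. apply core_complete; auto.
    specialize (Hmax R HR). lra.
  - destruct (dominated v (Hdom v Hv) Hout) as [u [Hu [Hguv Hd]]].
    assert (Hin : forall w, In w (remove Nat.eq_dec v L) <-> In w L /\ w <> v).
    { intros w; split; [apply in_remove|intros [? ?]; now apply in_in_remove]. }
    assert (Hu' : In u (remove Nat.eq_dec v L)).
    { apply Hin. split; [eauto|]. intros ->; lra. }
    apply (shadows_on_dominated L (remove Nat.eq_dec v L) u v); auto.
    + intros w. rewrite Hin. destruct (Nat.eq_dec w v) as [->|]; tauto.
    + rewrite Hin; tauto.
    + apply IH.
      * pose proof (remove_length_lt Nat.eq_dec L v Hv). lia.
      * intros E; rewrite E in Hu'; easy.
      * intros w Hw. apply Hin in Hw. apply Hdom, Hw.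
      * intros a b Hb Ha Hab. apply Hin in Hb. destruct Hb as [Hb _].
        apply Hin. split; [eauto|]. intros ->. specialize (Hmax b Hb). lra.
Qed.

Lemma cop_number_one_of_domination : (1 <= n)%nat -> cop_number_one n adj.
Proof.
  intros Hn. split; [|now apply not_cops_win_0].
  assert (Hseq : forall v, In v (seq 0 n) <-> (v < n)%nat).
  { intros v; rewrite in_seq; lia. }
  destruct (shadows_on_lower_set (length (seq 0 n)) (seq 0 n))
    as [F [k [c0 [Hc0 [HF0 [HFS HFk]]]]]]; auto.
  - destruct n; [lia|easy].
  - intros v; apply Hseq.
  - intros u v _ Hu _; now apply Hseq.
  - apply (cops_win_of_shadows F k c0).
    + intros R HR; apply HF0, Hseq, HR.
    + intros i R R' Hi HR Hst. apply HFS; auto; apply Hseq; auto.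
      destruct Hst as [->|Ha]; [assumption|apply (adj_dom _ _ Ha)].
    + intros R HR; apply HFk, Hseq, HR.
    + now apply Hseq.
Qed.
End Game.

(** * Domination towards the centre *)

Definition nrm (a b : R) : R := sqrt (a ^ 2 + b ^ 2).

Lemma nrm_ge0 a b : 0 <= nrm a b.
Proof. apply sqrt_pos. Qed.

Lemma nrm_sqr a b : nrm a b ^ 2 = a ^ 2 + b ^ 2.
Proof. unfold nrm. rewrite pow2_sqrt; nra. Qed.

Lemma nrm_le a b c : 0 <= c -> a ^ 2 + b ^ 2 <= c ^ 2 -> nrm a b <= c.
Proof.
  intros Hc H. pose proof (nrm_ge0 a b). pose proof (nrm_sqr a b). nra.
Qed.

Lemma nrm_cauchy_schwarz a b c d : a * c + b * d <= nrm a b * nrm c d.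
Proof.
  pose proof (nrm_ge0 a b). pose proof (nrm_ge0 c d).
  assert (H2 : (nrm a b * nrm c d) ^ 2 = (a ^ 2 + b ^ 2) * (c ^ 2 + d ^ 2)).
  { rewrite Rpow_mult_distr, !nrm_sqr. ring. }
  assert (0 <= nrm a b * nrm c d) by nra.
  assert ((a * c + b * d) ^ 2 <= (nrm a b * nrm c d) ^ 2).
  { rewrite H2. pose proof (pow2_ge_0 (a * d - b * c)). nra. }
  nra.
Qed.

Lemma nrm_triangle a b c d : nrm (a + c) (b + d) <= nrm a b + nrm c d.
Proof.
  pose proof (nrm_ge0 a b). pose proof (nrm_ge0 c d).
  apply nrm_le; [lra|].
  pose proof (nrm_cauchy_schwarz a b c d).
  pose proof (nrm_sqr a b). pose proof (nrm_sqr c d). nra.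
Qed.

Lemma nrm_scale k a b : 0 <= k -> nrm (k * a) (k * b) = k * nrm a b.
Proof.
  intros Hk. pose proof (nrm_ge0 a b). pose proof (nrm_sqr a b).
  apply Rsqr_inj; [apply nrm_ge0|nra|].
  unfold Rsqr. pose proof (nrm_sqr (k * a) (k * b)). nra.
Qed.

Lemma nrm_opp a b : nrm (- a) (- b) = nrm a b.
Proof. unfold nrm. f_equal. ring. Qed.

(* Polarization gives 2 (p - v).v <= - |p - v|^2 when |p| <= |v|, so moving
   [v] by a fraction [lam] towards the origin gains [lam * |p - v|^2]. *)
Lemma lens_in_disc vx vy px py lam zx zy tau r :
  0 <= lam <= 1 -> 0 <= r -> nrm zx zy <= tau ->
  nrm px py <= nrm vx vy -> nrm (px - vx) (py - vy) <= r ->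
  (lam * nrm vx vy + tau) ^ 2 + 2 * r * tau <= lam * r ^ 2 ->
  nrm (px - ((1 - lam) * vx + zx)) (py - ((1 - lam) * vy + zy)) <= r.
Proof.
  intros Hlam Hr Hz Hpv Hd Hmain.
  apply nrm_le; [assumption|].
  set (d := nrm (px - vx) (py - vy)) in *.
  assert (Hd0 : 0 <= d) by apply nrm_ge0.
  assert (Hz0 := nrm_ge0 zx zy).
  assert (Hdd : d ^ 2 = (px - vx) ^ 2 + (py - vy) ^ 2) by apply nrm_sqr.
  assert (Hpol : 2 * ((px - vx) * vx + (py - vy) * vy) <= - d ^ 2).
  { pose proof (nrm_sqr px py). pose proof (nrm_sqr vx vy).
    pose proof (nrm_ge0 px py). nra. }
  assert (Hcs : - ((px - vx) * zx + (py - vy) * zy) <= d * tau).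
  { pose proof (nrm_cauchy_schwarz (px - vx) (py - vy) (- zx) (- zy)) as H.
    rewrite nrm_opp in H. fold d in H. nra. }
  (* [w] is the displacement from [v] to the new centre, so the squared distance expands as
     [d^2 - 2 (p - v).w + |w|^2]. *)
  set (wx := - (lam * vx) + zx). set (wy := - (lam * vy) + zy).
  assert (Hw : wx ^ 2 + wy ^ 2 <= (lam * nrm vx vy + tau) ^ 2).
  { rewrite <- nrm_sqr.
    pose proof (nrm_triangle (- (lam * vx)) (- (lam * vy)) zx zy) as H.
    rewrite nrm_opp, nrm_scale in H by lra. fold wx wy in H.
    pose proof (nrm_ge0 wx wy). nra. }
  assert (E : (px - ((1 - lam) * vx + zx)) ^ 2 + (py - ((1 - lam) * vy + zy)) ^ 2
    = d ^ 2 + lam * (2 * ((px - vx) * vx + (py - vy) * vy))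
      + 2 * - ((px - vx) * zx + (py - vy) * zy) + (wx ^ 2 + wy ^ 2)).
  { rewrite Hdd. unfold wx, wy. ring. }
  rewrite E.
  assert (lam * (2 * ((px - vx) * vx + (py - vy) * vy)) <= lam * (- d ^ 2)) by nra.
  assert (d ^ 2 <= r ^ 2) by nra.
  (* Each remaining [d] has a nonnegative coefficient and is replaced by [r]; what is left is
     [Hmain]. *)
  assert ((1 - lam) * d ^ 2 <= (1 - lam) * r ^ 2) by nra.
  assert (d * tau <= r * tau) by nra.
  nra.
Qed.

(** Here [v0] will be the corner of the cell of [v], so that the admissible [u] depend on that cell
    alone. The error [2 * h] of [u] and the error [2 * h] from replacing [v0] by [v] add up to
    [tau = 4 * h] in [lens_in_disc]. *)
Lemma inward_point_dominates v0x v0y vx vy ux uy s r h :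
  0 < r <= 3 / 2 -> 0 < h -> 200 * h <= r ^ 3 ->
  nrm v0x v0y <= 1 -> nrm (vx - v0x) (vy - v0y) <= 2 * h -> r / 2 < nrm vx vy ->
  r ^ 2 / 8 <= s <= r ^ 2 / 4 ->
  nrm (ux - (1 - s / nrm v0x v0y) * v0x) (uy - (1 - s / nrm v0x v0y) * v0y)
    <= 2 * h ->
  nrm ux uy < nrm vx vy /\
  forall px py, nrm px py <= nrm vx vy -> nrm (px - vx) (py - vy) <= r ->
    nrm (px - ux) (py - uy) <= r.
Proof.
  intros Hr Hh HhC Hv01 Hvv0 Hv Hs Hu.
  set (rho0 := nrm v0x v0y) in *. set (rho := nrm vx vy) in *.
  assert (Hr3 : r ^ 3 <= 3 / 2 * r ^ 2) by nra.
  assert (Hr3' : r ^ 3 <= 9 / 4 * r) by nra.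
  assert (Hr2 : 0 < r ^ 2 <= 3 / 2 * r) by nra.
  assert (Hvle : rho <= rho0 + 2 * h).
  { pose proof (nrm_triangle v0x v0y (vx - v0x) (vy - v0y)) as H.
    replace (v0x + (vx - v0x)) with vx in H by ring.
    replace (v0y + (vy - v0y)) with vy in H by ring.
    fold rho rho0 in H. lra. }
  assert (Hv0le : rho0 <= rho + 2 * h).
  { pose proof (nrm_triangle vx vy (- (vx - v0x)) (- (vy - v0y))) as H.
    replace (vx + - (vx - v0x)) with v0x in H by ring.
    replace (vy + - (vy - v0y)) with v0y in H by ring.
    rewrite nrm_opp in H. fold rho rho0 in H. lra. }
  (* Since [r <= 3 / 2], [s <= r^2 / 4 <= 3 r / 8], which is below [r / 2 - 2 * h]: the step does
     not overshoot the centre. *)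
  assert (Hs0 : s <= rho0) by lra.
  assert (Hrho0 : 0 < rho0) by lra.
  set (lam := s / rho0) in *.
  assert (Els : lam * rho0 = s) by (unfold lam; field; lra).
  assert (Hlam : 0 < lam <= 1) by (split; nra).
  set (zx := ux - (1 - lam) * vx). set (zy := uy - (1 - lam) * vy).
  assert (Hz : nrm zx zy <= 4 * h).
  { pose proof (nrm_triangle (ux - (1 - lam) * v0x) (uy - (1 - lam) * v0y)
      ((1 - lam) * - (vx - v0x)) ((1 - lam) * - (vy - v0y))) as H.
    rewrite nrm_scale, nrm_opp in H by lra.
    replace (ux - (1 - lam) * v0x + (1 - lam) * - (vx - v0x)) with zx in H
      by (unfold zx; ring).
    replace (uy - (1 - lam) * v0y + (1 - lam) * - (vy - v0y)) with zy in H
      by (unfold zy; ring).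
    pose proof (nrm_ge0 (vx - v0x) (vy - v0y)). nra. }
  assert (Hux : ux = (1 - lam) * vx + zx) by (unfold zx; ring).
  assert (Huy : uy = (1 - lam) * vy + zy) by (unfold zy; ring).
  assert (Hlr : s - 2 * h <= lam * rho <= s + 2 * h) by nra.
  split.
  - pose proof (nrm_triangle ((1 - lam) * vx) ((1 - lam) * vy) zx zy) as H.
    rewrite nrm_scale in H by lra. rewrite <- Hux, <- Huy in H. fold rho in H.
    nra.
  - intros px py Hp Hd. rewrite Hux, Huy.
    apply lens_in_disc with (tau := 4 * h); auto; try lra.
    fold rho.
    (* This uses [rho0 <= 1]. The gain [lam * r^2] is then at least [s * r^2], of order [r^4], and
       exceeds the losses computed below. *)
    assert (s <= lam) by nra.
    assert (s * r ^ 2 <= lam * r ^ 2) by nra.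
    assert (Hsq : (lam * rho + 4 * h) ^ 2 <= (s + 6 * h) ^ 2) by nra.
    assert (Hh' : 6 * h <= r ^ 2 * (9 / 200)) by lra.
    assert (Hsq2 : (s + 6 * h) ^ 2 <= (s + r ^ 2 * (9 / 200)) ^ 2) by nra.
    assert (Hrh : 2 * r * (4 * h) <= r ^ 2 * r ^ 2 / 25) by nra.
    nra.
Qed.

(** * Covers by boxes and cells *)

Definition total_vol (d : nat) (L : list ((nat -> R) * (nat -> R))) : R :=
  fold_right (fun b acc => box_vol d (fst b) (snd b) + acc) 0 L.

(** Lists make unions and products of covers easy. Boxes are ordered in every coordinate, also
    beyond [d], to match [outer_measure_le]. *)
Definition finite_cover (d : nat) (S : (nat -> R) -> Prop) (v : R) : Prop :=
  exists L : list ((nat -> R) * (nat -> R)),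
    (forall b, In b L -> forall k, fst b k <= snd b k) /\
    (forall x, S x -> exists b, In b L /\ in_box d (fst b) (snd b) x) /\
    total_vol d L <= v.

Lemma box_vol_ge0 d a b : (forall k, a k <= b k) -> 0 <= box_vol d a b.
Proof.
  intros H; induction d as [|d IH]; simpl; [lra|].
  specialize (H d). apply Rmult_le_pos; lra.
Qed.

Lemma box_vol_ext d a b a' b' :
  (forall k, (k < d)%nat -> a k = a' k /\ b k = b' k) ->
  box_vol d a b = box_vol d a' b'.
Proof.
  induction d as [|d IH]; intros H; simpl; [reflexivity|].
  destruct (H d) as [-> ->]; [lia|]. rewrite IH; auto.
Qed.

Lemma total_vol_app d L L' : total_vol d (L ++ L') = total_vol d L + total_vol d L'.
Proof. induction L as [|b L IH]; simpl; [lra|]. rewrite IH; ring. Qed.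

Lemma finite_cover_mono d (S S' : (nat -> R) -> Prop) v v' :
  (forall x, S x -> S' x) -> v' <= v -> finite_cover d S' v' -> finite_cover d S v.
Proof.
  intros HS Hv [L [H1 [H2 H3]]]. exists L. repeat split; auto; lra.
Qed.

Lemma finite_cover_union (I : Type) (l : list I) d (S : I -> (nat -> R) -> Prop) v :
  (forall i, In i l -> finite_cover d (S i) v) ->
  finite_cover d (fun x => exists i, In i l /\ S i x) (INR (length l) * v).
Proof.
  induction l as [|i l IH]; intros H.
  - exists []. simpl. repeat split; [easy| |lra]. intros x [j [[] _]].
  - destruct (H i) as [L [H1 [H2 H3]]]; [now left|].
    destruct IH as [L' [H1' [H2' H3']]]; [intros; apply H; now right|].
    exists (L ++ L'). split; [|split].
    + intros b Hb. apply in_app_or in Hb. destruct Hb; auto.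
    + intros x [j [[<-|Hj] Hx]].
      * destruct (H2 x Hx) as [b [? ?]]. exists b. rewrite in_app_iff; auto.
      * destruct (H2' x) as [b [? ?]]; [eauto|]. exists b. rewrite in_app_iff; auto.
    + rewrite total_vol_app. cbn [length]. rewrite S_INR. lra.
Qed.

(** The list is padded with the box reduced to the origin, whose volume is [0] as soon as [d >= 1];
    in dimension [0] it would be [1]. *)
Lemma outer_measure_le_of_finite_cover d (S : (nat -> R) -> Prop) v :
  (1 <= d)%nat -> finite_cover d S v -> outer_measure_le d S v.
Proof.
  intros Hd [L [H1 [H2 H3]]].
  set (z := (fun _ : nat => 0, fun _ : nat => 0)).
  exists (fun j => fst (nth j L z)), (fun j => snd (nth j L z)).
  split; [|split].
  - intros j k. destruct (nth_in_or_default j L z) as [Hin|E]; [auto|].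
    rewrite E; simpl; lra.
  - intros x Hx. destruct (H2 x Hx) as [b [Hb Hin]].
    destruct (In_nth L b z Hb) as [j [_ <-]]. exists j; exact Hin.
  - intros m. apply Rle_trans with (2 := H3). clear H2 H3 v.
    assert (Hshift : forall m f, sum_to (Datatypes.S m) f
              = f 0%nat + sum_to m (fun j => f (Datatypes.S j))).
    { clear. induction m as [|m IH]; intros f; [simpl; ring|].
      cbn [sum_to] in *. rewrite IH. ring. }
    revert m; induction L as [|b L IH]; intros m.
    + assert (Hz : box_vol d (fst z) (snd z) = 0).
      { destruct d; [lia|]. simpl. ring. }
      induction m as [|m IHm]; [simpl; lra|].
      cbn [sum_to]. destruct m; cbn [nth] in *; rewrite Hz; simpl in *; lra.
    + assert (Hpos : forall L', (forall b, In b L' -> forall k, fst b k <= snd b k) ->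
                 0 <= total_vol d L').
      { clear. induction L' as [|b L IH]; intros H; simpl; [lra|].
        pose proof (box_vol_ge0 d (fst b) (snd b) (H b (or_introl eq_refl))).
        specialize (IH (fun c Hc => H c (or_intror Hc))). lra. }
      destruct m as [|m]; [cbn [sum_to]; auto|].
      rewrite Hshift. cbn [nth]. cbn [total_vol fold_right].
      apply Rplus_le_compat_l. apply IH. intros; apply H1; now right.
Qed.

Definition in_cell (h : R) (c : nat * nat) (p q : R) : Prop :=
  INR (fst c) * h <= p <= (INR (fst c) + 1) * h /\
  INR (snd c) * h <= q <= (INR (snd c) + 1) * h.

(** Appends the coordinates of one more point. Repeating [q] at all later indices keeps boxes
    ordered there too. *)
Definition ext (d : nat) (a : nat -> R) (p q : R) : nat -> R :=
  fun k => if k <? d then a k else if k =? d then p else q.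

Lemma ext_lt d a p q k : (k < d)%nat -> ext d a p q k = a k.
Proof. intros H. unfold ext. now rewrite (proj2 (Nat.ltb_lt k d) H). Qed.

Lemma ext_fst d a p q : ext d a p q d = p.
Proof. unfold ext. now rewrite Nat.ltb_irrefl, Nat.eqb_refl. Qed.

Lemma ext_snd d a p q : ext d a p q (S d) = q.
Proof.
  unfold ext. rewrite (proj2 (Nat.ltb_ge (S d) d)) by lia.
  now rewrite (proj2 (Nat.eqb_neq (S d) d)) by lia.
Qed.

Lemma ext_le d a p q a' p' q' :
  (forall k, a k <= a' k) -> p <= p' -> q <= q' ->
  forall k, ext d a p q k <= ext d a' p' q' k.
Proof.
  intros Ha Hp Hq k. unfold ext. destruct (k <? d); [auto|].
  destruct (k =? d); auto.
Qed.

(** One box for each choice of a cell per point: the product cover, built by adding one point at a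
    time. *)
Lemma finite_cover_points_in_cells h (cells : list (nat * nat)) (n : nat) :
  0 <= h ->
  finite_cover (2 * n)
    (fun x => forall j, (j < n)%nat ->
       exists c, In c cells /\ in_cell h c (ptx x j) (pty x j))
    ((INR (length cells) * h ^ 2) ^ n).
Proof.
  intros Hh. induction n as [|n [L [H1 [H2 H3]]]].
  { exists [(fun _ => 0, fun _ => 0)]. simpl. repeat split; try lra.
    - intros b [<-|[]] k; simpl; lra.
    - intros x _. eexists; split; [now left|]. intros k Hk; lia. }
  replace (2 * S n)%nat with (S (S (2 * n))) by lia.
  set (d := (2 * n)%nat) in *.
  set (e := fun (c : nat * nat) (b : (nat -> R) * (nat -> R)) =>
    (ext d (fst b) (INR (fst c) * h) (INR (snd c) * h),
     ext d (snd b) ((INR (fst c) + 1) * h) ((INR (snd c) + 1) * h))).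
  exists (flat_map (fun c => map (e c) L) cells). split; [|split].
  - intros b Hb. apply in_flat_map in Hb. destruct Hb as [c [_ Hb]].
    apply in_map_iff in Hb. destruct Hb as [b' [<- Hb']].
    apply ext_le; [auto|nra|nra].
  - intros x Hx.
    destruct (H2 x) as [b [Hb Hin]]; [intros; apply Hx; lia|].
    destruct (Hx n) as [c [Hc [Hcx Hcy]]]; [lia|].
    unfold ptx, pty in Hcx, Hcy. fold d in Hcx, Hcy.
    replace (d + 1)%nat with (S d) in Hcy by lia.
    exists (e c b). split.
    + apply in_flat_map. exists c. split; [assumption|]. now apply in_map.
    + intros k Hk. cbn [e fst snd].
      destruct (lt_eq_lt_dec k d) as [[Hlt| ->]|Hgt].
      * rewrite !ext_lt by assumption. auto.
      * rewrite !ext_fst. assumption.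
      * replace k with (S d) by lia. rewrite !ext_snd. assumption.
  - assert (Hcell : forall c, total_vol (S (S d)) (map (e c) L) = total_vol d L * h ^ 2).
    { intros c. clear. induction L as [|b L IH]; [simpl; ring|].
      cbn [map total_vol fold_right]. fold (total_vol (S (S d)) (map (e c) L)).
      fold (total_vol d L). rewrite IH.
      cbn [box_vol e fst snd]. rewrite !ext_fst, !ext_snd.
      rewrite (box_vol_ext d _ _ (fst b) (snd b)).
      - ring.
      - intros k Hk. now rewrite !ext_lt. }
    assert (Hsum : total_vol (S (S d)) (flat_map (fun c => map (e c) L) cells)
                   = INR (length cells) * (total_vol d L * h ^ 2)).
    { clear - Hcell. induction cells as [|c cells IH].
      - simpl. ring.
      - cbn [flat_map length]. rewrite total_vol_app, Hcell, IH, S_INR. ring. }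
    rewrite Hsum. cbn [pow].
    assert (0 <= INR (length cells) * h ^ 2)
      by (pose proof (pos_INR (length cells)); nra).
    cbn [pow] in *. nra.
Qed.

(** * Grid cells of the unit square and the event of avoiding some of them *)

Definition grid (M : nat) : list (nat * nat) := list_prod (seq 0 M) (seq 0 M).

Lemma in_grid M c : In c (grid M) <-> (fst c < M)%nat /\ (snd c < M)%nat.
Proof.
  destruct c as [a b]. unfold grid. rewrite in_prod_iff, !in_seq. simpl. lia.
Qed.

Lemma length_grid M : length (grid M) = (M * M)%nat.
Proof. unfold grid. now rewrite length_prod, !length_seq. Qed.

Lemma NoDup_list_prod (A B : Type) (l : list A) (l' : list B) :
  NoDup l -> NoDup l' -> NoDup (list_prod l l').
Proof.
  intros Hl Hl'. induction Hl as [|a l Ha _ IH]; simpl; [constructor|].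
  apply NoDup_app; [|exact IH|].
  - apply Injective_map_NoDup; [|exact Hl']. intros b b' E; now injection E.
  - intros c Hc Hc'. apply in_map_iff in Hc. destruct Hc as [b [<- _]].
    apply in_prod_iff in Hc'. tauto.
Qed.

Lemma exists_subinterval M h p :
  (1 <= M)%nat -> 0 <= p <= INR M * h ->
  exists a, (a < M)%nat /\ INR a * h <= p <= (INR a + 1) * h.
Proof.
  induction M as [|M IH]; intros HM Hp; [lia|].
  rewrite S_INR in Hp.
  destruct (Rle_dec (INR M * h) p) as [Hle|Hgt].
  - exists M. split; [lia|]. lra.
  - destruct M as [|M]; [simpl in Hgt; lra|].
    destruct IH as [a [Ha Hpa]]; [lia|lra|]. exists a. split; [lia|assumption].
Qed.

Lemma exists_cell M h p q :
  (1 <= M)%nat -> INR M * h = 1 -> 0 <= p <= 1 -> 0 <= q <= 1 ->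
  exists c, In c (grid M) /\ in_cell h c p q.
Proof.
  intros HM HMh Hp Hq.
  destruct (exists_subinterval M h p) as [a [Ha Hpa]]; [auto|lra|].
  destruct (exists_subinterval M h q) as [b [Hb Hqb]]; [auto|lra|].
  exists (a, b). split; [apply in_grid; auto|]. split; assumption.
Qed.

Lemma in_cell_close h c p q p' q' :
  0 <= h -> in_cell h c p q -> in_cell h c p' q' ->
  (p - p') ^ 2 + (q - q') ^ 2 <= 2 * h ^ 2.
Proof.
  intros Hh [[? ?] [? ?]] [[? ?] [? ?]].
  assert (- h <= p - p' <= h) by lra. assert (- h <= q - q' <= h) by lra. nra.
Qed.

(** Points at spacing [2 * h] on the segment from [w] to the centre lie in distinct cells, whose
    diameter is only [sqrt 2 * h]. *)
Lemma line_cells M h (wx wy s0 : R) (J : nat) :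
  (1 <= M)%nat -> 0 < h -> INR M * h = 1 ->
  -1 / 2 <= wx <= 1 / 2 -> -1 / 2 <= wy <= 1 / 2 ->
  0 < nrm wx wy -> 0 <= s0 -> s0 + 2 * h * INR J <= nrm wx wy ->
  exists Q, NoDup Q /\ length Q = J /\ incl Q (grid M) /\
    forall c, In c Q -> exists s, s0 <= s <= s0 + 2 * h * INR J /\
      in_cell h c (1 / 2 + (1 - s / nrm wx wy) * wx) (1 / 2 + (1 - s / nrm wx wy) * wy).
Proof.
  intros HM Hh HMh Hwx Hwy Hrho Hs0.
  set (rho := nrm wx wy) in *.
  assert (Hpt : forall s, 0 <= s <= rho -> exists c, In c (grid M) /\
    in_cell h c (1 / 2 + (1 - s / rho) * wx) (1 / 2 + (1 - s / rho) * wy)).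
  { intros s Hs. assert (Hl : 0 <= s / rho <= 1).
    { assert (E : s / rho * rho = s) by (field; lra). split; nra. }
    apply exists_cell; auto; nra. }
  assert (Hfar : forall s t, 2 * h <= t - s ->
    2 * h ^ 2 <
    (1 / 2 + (1 - s / rho) * wx - (1 / 2 + (1 - t / rho) * wx)) ^ 2 +
    (1 / 2 + (1 - s / rho) * wy - (1 / 2 + (1 - t / rho) * wy)) ^ 2).
  { intros s t Hst.
    replace (_ + _) with (((t - s) / rho) ^ 2 * (wx ^ 2 + wy ^ 2))
      by (field; lra).
    rewrite <- nrm_sqr. fold rho.
    replace (((t - s) / rho) ^ 2 * rho ^ 2) with ((t - s) ^ 2) by (field; lra).
    nra. }
  (* The sharper bound with [INR J - 1] keeps a further point [2 * h] away from
     all earlier ones, hence in a new cell. *)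
  cut (s0 + 2 * h * INR J <= rho ->
    exists Q, NoDup Q /\ length Q = J /\ incl Q (grid M) /\
    forall c, In c Q -> exists s, s0 <= s <= s0 + 2 * h * (INR J - 1) /\
      in_cell h c (1 / 2 + (1 - s / rho) * wx) (1 / 2 + (1 - s / rho) * wy)).
  { intros Hcut Hle. destruct (Hcut Hle) as [Q [H1 [H2 [H3 H4]]]].
    exists Q. repeat split; auto. intros c Hc.
    destruct (H4 c Hc) as [s [Hs Hin]]. exists s. split; [lra|assumption]. }
  induction J as [|J IH]; intros Hle.
  { exists []. repeat split; [constructor|easy|easy]. }
  rewrite S_INR in Hle. pose proof (pos_INR J).
  destruct IH as [Q [H1 [H2 [H3 H4]]]]; [nra|].
  destruct (Hpt (s0 + 2 * h * INR J)) as [c [Hc Hin]]; [split; nra|].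
  exists (c :: Q). split; [|split; [|split]].
  - constructor; [|assumption]. intros HcQ.
    destruct (H4 c HcQ) as [s [Hs Hin']].
    pose proof (Hfar s (s0 + 2 * h * INR J) ltac:(lra)).
    pose proof (in_cell_close h c _ _ _ _ (Rlt_le _ _ Hh) Hin' Hin). lra.
  - simpl; congruence.
  - intros c' [<-|Hc']; auto.
  - rewrite S_INR. intros c' [<-|Hc'].
    + exists (s0 + 2 * h * INR J). split; [split; nra|assumption].
    + destruct (H4 c' Hc') as [s [Hs Hs']]. exists s. split; [lra|assumption].
Qed.

(** Every point lies in one of the remaining cells, of total area at most [1 - |Q| h^2]; then
    [1 - t <= exp (- t)] is raised to the power [n]. *)
Lemma finite_cover_avoiding_cells M h (Q : list (nat * nat)) (n : nat) :
  (1 <= M)%nat -> 0 < h -> INR M * h = 1 -> NoDup Q -> incl Q (grid M) ->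
  finite_cover (2 * n)
    (fun x => in_unit_cube (2 * n) x /\
       forall j c, (j < n)%nat -> In c Q -> ~ in_cell h c (ptx x j) (pty x j))
    (exp (- (INR n * (INR (length Q) * h ^ 2)))).
Proof.
  intros HM Hh HMh HQ HQM.
  set (dec := fun a b : nat * nat => excluded_middle_informative (a = b)).
  set (cells := filter (fun c => if in_dec dec c Q then false else true)
                  (grid M)).
  assert (Hcells : forall c, In c cells <-> In c (grid M) /\ ~ In c Q).
  { intros c. unfold cells. rewrite filter_In.
    destruct (in_dec dec c Q); intuition easy. }
  assert (Hlen : (length cells + length Q <= M * M)%nat).
  { rewrite <- length_grid, <- length_app. apply NoDup_incl_length.
    - apply NoDup_app; auto.
      + apply NoDup_filter, NoDup_list_prod; apply seq_NoDup.
      + intros c Hc. now apply Hcells.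
    - intros c Hc. apply in_app_or in Hc. destruct Hc as [Hc|Hc]; auto.
      now apply Hcells. }
  apply (finite_cover_mono _ _
    (fun x => forall j, (j < n)%nat ->
       exists c, In c cells /\ in_cell h c (ptx x j) (pty x j))
    _ ((INR (length cells) * h ^ 2) ^ n)).
  - intros x [Hx Hno] j Hj.
    destruct (exists_cell M h (ptx x j) (pty x j)) as [c [Hc Hin]]; auto;
      try (apply Hx; lia).
    exists c. split; [|assumption]. apply Hcells. split; [assumption|].
    intros HcQ. exact (Hno j c Hj HcQ Hin).
  - assert (H0 : 0 <= INR (length cells) * h ^ 2)
      by (pose proof (pos_INR (length cells)); nra).
    assert (H1 : INR (length cells) * h ^ 2 <= 1 - INR (length Q) * h ^ 2).
    { apply le_INR in Hlen. rewrite plus_INR, mult_INR in Hlen.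
      assert (E : INR M * INR M * h ^ 2 = 1)
        by (replace (INR M * INR M * h ^ 2) with ((INR M * h) ^ 2) by ring;
            rewrite HMh; ring).
      nra. }
    apply Rle_trans with (exp (- (INR (length Q) * h ^ 2)) ^ n).
    + apply pow_incr. split; [assumption|].
      pose proof (exp_ineq1_le (- (INR (length Q) * h ^ 2))). lra.
    + rewrite <- Rpower_pow by apply exp_pos. unfold Rpower. rewrite ln_exp.
      apply Req_le. f_equal. ring.
  - apply finite_cover_points_in_cells; lra.
Qed.

(** * Undominated vertices are unlikely *)

Definition center_dist (x : nat -> R) (i : nat) : R :=
  nrm (ptx x i - 1 / 2) (pty x i - 1 / 2).

(** The failure of the hypothesis [dominated] at [v], for [g = center_dist x] and [rho = r / 2],
    expressed by distances. *)
Definition undominated (n : nat) (r : R) (x : nat -> R) (v : nat) : Prop :=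
  r / 2 < center_dist x v /\
  forall u, (u < n)%nat -> center_dist x u < center_dist x v ->
    exists w, (w < n)%nat /\ center_dist x w <= center_dist x v /\
      dist2 x w v <= r /\ r < dist2 x w u.

Lemma dist2_sym x i j : dist2 x i j = dist2 x j i.
Proof. unfold dist2. f_equal. ring. Qed.

Lemma dist2_le_center x i j : dist2 x i j <= center_dist x i + center_dist x j.
Proof.
  pose proof (nrm_triangle (ptx x i - 1 / 2) (pty x i - 1 / 2)
    (- (ptx x j - 1 / 2)) (- (pty x j - 1 / 2))) as H.
  rewrite nrm_opp in H.
  replace (ptx x i - 1 / 2 + - (ptx x j - 1 / 2)) with (ptx x i - ptx x j) in H by ring.
  replace (pty x i - 1 / 2 + - (pty x j - 1 / 2)) with (pty x i - pty x j) in H by ring.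
  exact H.
Qed.

Lemma step_rgg n x r u v :
  0 <= r -> (u < n)%nat -> (v < n)%nat ->
  step (rgg_adj n x r) u v <-> dist2 x u v <= r.
Proof.
  intros Hr Hu Hv. split.
  - intros [->|[_ [_ [_ H]]]]; [|exact H].
    unfold dist2. rewrite !Rminus_diag.
    replace (0 ^ 2 + 0 ^ 2) with 0 by ring. now rewrite sqrt_0.
  - intros H. destruct (Nat.eq_dec v u) as [->|Hne]; [now left|].
    right. unfold rgg_adj. auto.
Qed.

Lemma bad_event_undominated n r x :
  (1 <= n)%nat -> 0 <= r -> bad_event n r x ->
  in_unit_cube (2 * n) x /\ exists v, (v < n)%nat /\ undominated n r x v.
Proof.
  intros Hn Hr [Hx Hbad]. split; [exact Hx|].
  apply NNPP. intros Hno. apply Hbad.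
  apply cop_number_one_of_domination with (g := center_dist x) (rho := r / 2); auto.
  - intros u v [Hu [Hv _]]; auto.
  - intros u v [Hu [Hv [Hne Hd]]]. unfold rgg_adj. rewrite dist2_sym; auto.
  - intros u v Hu Hv Hgu Hgv. apply step_rgg; auto.
    pose proof (dist2_le_center x u v). lra.
  - intros v Hv Hgv. apply NNPP. intros Hu. apply Hno. exists v.
    split; [exact Hv|]. split; [exact Hgv|]. intros u Hun Huv.
    apply NNPP. intros Hw. apply Hu. exists u. split; [exact Hun|].
    split; [exact Huv|]. intros w Hwn Hwv Hst. apply step_rgg; auto.
    apply step_rgg in Hst; auto. rewrite dist2_sym in Hst |- *.
    apply Rnot_lt_le. intros Hlt. apply Hw. exists w. auto.
Qed.

Lemma in_cell_nrm_close h c p q p' q' :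
  0 <= h -> in_cell h c p q -> in_cell h c p' q' -> nrm (p - p') (q - q') <= 2 * h.
Proof.
  intros Hh H H'. apply nrm_le; [lra|].
  pose proof (in_cell_close h c p q p' q' Hh H H'). nra.
Qed.

(** The corner [w] of [c] determines [J] cells along the segment with [s] between [r^2 / 8] and
    [r^2 / 4]. A vertex in any of them would dominate [v], so all points avoid these cells. *)
Lemma finite_cover_undominated_in_cell n M h r J c :
  0 < r <= 3 / 2 -> (1 <= M)%nat -> 0 < h -> INR M * h = 1 -> 200 * h <= r ^ 3 ->
  2 * h * INR J <= r ^ 2 / 8 -> In c (grid M) ->
  finite_cover (2 * n)
    (fun x => in_unit_cube (2 * n) x /\ exists v, (v < n)%nat /\
       in_cell h c (ptx x v) (pty x v) /\ undominated n r x v)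
    (exp (- (INR n * (INR J * h ^ 2)))).
Proof.
  intros Hr HM Hh HMh HhC HJ Hc.
  set (wx := INR (fst c) * h - 1 / 2). set (wy := INR (snd c) * h - 1 / 2).
  apply in_grid in Hc. destruct Hc as [Hc1 Hc2].
  assert (Hcoord : forall a, (a < M)%nat -> 0 <= INR a * h <= 1).
  { intros a Ha. apply lt_INR in Ha. pose proof (pos_INR a). split; nra. }
  assert (Hcor : in_cell h c (wx + 1 / 2) (wy + 1 / 2)).
  { unfold in_cell, wx, wy. repeat split; lra. }
  assert (Hwx : -1 / 2 <= wx <= 1 / 2)
    by (specialize (Hcoord _ Hc1); unfold wx; lra).
  assert (Hwy : -1 / 2 <= wy <= 1 / 2)
    by (specialize (Hcoord _ Hc2); unfold wy; lra).
  assert (Hw1 : nrm wx wy <= 1) by (apply nrm_le; nra).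
  assert (Hnear : forall p q, in_cell h c p q ->
            nrm (p - 1 / 2 - wx) (q - 1 / 2 - wy) <= 2 * h).
  { intros p q Hpq.
    replace (p - 1 / 2 - wx) with (p - (wx + 1 / 2)) by ring.
    replace (q - 1 / 2 - wy) with (q - (wy + 1 / 2)) by ring.
    apply in_cell_nrm_close with c; auto; lra. }
  destruct (Rlt_le_dec (nrm wx wy) (r / 2 - 2 * h)) as [Hsmall|Hbig].
  (* The whole cell lies within [r / 2] of the centre, so the event is empty. *)
  { exists []. split; [easy|]. split; [|apply Rlt_le, exp_pos].
    intros x [_ [v [_ [Hv [Hrv _]]]]]. exfalso. apply Hnear in Hv.
    pose proof (nrm_triangle wx wy (ptx x v - 1 / 2 - wx) (pty x v - 1 / 2 - wy)) as H.
    replace (wx + (ptx x v - 1 / 2 - wx)) with (ptx x v - 1 / 2) in H by ring.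
    replace (wy + (pty x v - 1 / 2 - wy)) with (pty x v - 1 / 2) in H by ring.
    unfold center_dist in Hrv. lra. }
  assert (Hr3' : r ^ 3 <= 9 / 4 * r) by nra.
  assert (Hr2 : 0 < r ^ 2 <= 3 / 2 * r) by nra.
  destruct (line_cells M h wx wy (r ^ 2 / 8) J) as [Q [HQ1 [HQ2 [HQ3 HQ4]]]];
    auto; try lra.
  rewrite <- HQ2.
  eapply finite_cover_mono;
    [|apply Rle_refl|apply (finite_cover_avoiding_cells M h Q n); auto].
  intros x [Hx [v [Hv [Hvc [Hrv Hund]]]]]. split; [exact Hx|].
  intros j c' Hj Hc' Hin.
  destruct (HQ4 c' Hc') as [s [Hs Hline]].
  (* For [j = v] already the strict inequality [Hlt] is absurd, so [v] avoids the cells as well and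
     the exponent is [n] rather than [n - 1]. *)
  destruct (inward_point_dominates wx wy (ptx x v - 1 / 2) (pty x v - 1 / 2)
    (ptx x j - 1 / 2) (pty x j - 1 / 2) s r h) as [Hlt Hdom]; auto; try lra.
  { set (lam := s / nrm wx wy) in *.
    replace (ptx x j - 1 / 2 - (1 - lam) * wx)
      with (ptx x j - (1 / 2 + (1 - lam) * wx)) by ring.
    replace (pty x j - 1 / 2 - (1 - lam) * wy)
      with (pty x j - (1 / 2 + (1 - lam) * wy)) by ring.
    apply in_cell_nrm_close with c'; auto; lra. }
  destruct (Hund j Hj Hlt) as [w [Hw [Hwv [Hd Hd']]]].
  specialize (Hdom (ptx x w - 1 / 2) (pty x w - 1 / 2) Hwv).
  replace (ptx x w - 1 / 2 - (ptx x v - 1 / 2)) with (ptx x w - ptx x v) in Hdom by ring.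
  replace (pty x w - 1 / 2 - (pty x v - 1 / 2)) with (pty x w - pty x v) in Hdom by ring.
  replace (ptx x w - 1 / 2 - (ptx x j - 1 / 2)) with (ptx x w - ptx x j) in Hdom by ring.
  replace (pty x w - 1 / 2 - (pty x j - 1 / 2)) with (pty x w - pty x j) in Hdom by ring.
  unfold nrm in Hdom. unfold dist2 in Hd, Hd'. specialize (Hdom Hd). lra.
Qed.

(** * Choice of the grid and the union bound *)

Lemma nat_floor x : 0 <= x -> exists m : nat, INR m <= x < INR m + 1.
Proof.
  intros Hx. destruct (archimed x) as [H1 H2].
  assert (Hup : (0 < up x)%Z) by (apply lt_IZR; lra).
  exists (Z.to_nat (up x - 1)).
  rewrite INR_IZR_INZ, Z2Nat.id by lia. rewrite minus_IZR. lra.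
Qed.

(** Take [M] just above [200 / r^3], [h = 1 / M] and [J] the floor of [r^2 / (16 h)]. Rounding costs
    at most [r^3 <= 27 / 8], so [M r^3 <= 204]; then [J h >= r^2 / 32] and [h >= r^3 / 204] give
    [J h^2 >= r^5 / 6528], and [204^2 <= 50000]. *)
Lemma grid_parameters r :
  0 < r <= 3 / 2 ->
  exists (M J : nat) (h : R),
    (1 <= M)%nat /\ 0 < h /\ INR M * h = 1 /\ 200 * h <= r ^ 3 /\
    2 * h * INR J <= r ^ 2 / 8 /\
    r ^ 5 / 7000 <= INR J * h ^ 2 /\ INR (M * M) * r ^ 6 <= 50000.
Proof.
  intros Hr.
  assert (Hr3 : 0 < r ^ 3 <= 27 / 8) 
    by (split; [now apply pow_lt|];
        apply Rle_trans with ((3 / 2) ^ 3); [apply pow_incr|]; lra).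
  destruct (nat_floor (200 / r ^ 3)) as [m [Hm1 Hm2]].
  { apply Rlt_le, Rdiv_lt_0_compat; lra. }
  set (h := / INR (S m)).
  assert (HM : 0 < INR (S m)) by (apply lt_0_INR; lia).
  assert (Hh : 0 < h) by now apply Rinv_0_lt_compat.
  assert (HMh : INR (S m) * h = 1) by (unfold h; field; lra).
  assert (E : 200 / r ^ 3 * r ^ 3 = 200) by (field; lra).
  assert (HMlow : 200 <= INR (S m) * r ^ 3) by (rewrite S_INR; nra).
  assert (HMup : INR (S m) * r ^ 3 <= 204) by (rewrite S_INR; nra).
  assert (Hhup : 200 * h <= r ^ 3).
  { replace (r ^ 3) with (INR (S m) * h * r ^ 3) by (rewrite HMh; ring). nra. }
  assert (Hhlow : r ^ 3 <= 204 * h).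
  { replace (r ^ 3) with (INR (S m) * h * r ^ 3) by (rewrite HMh; ring). nra. }
  destruct (nat_floor (r ^ 2 / (16 * h))) as [J [HJ1 HJ2]].
  { apply Rlt_le, Rdiv_lt_0_compat; nra. }
  assert (E2 : r ^ 2 / (16 * h) * (16 * h) = r ^ 2) by (field; lra).
  assert (HJup : INR J * (16 * h) <= r ^ 2) by nra.
  assert (HJlow : r ^ 2 < (INR J + 1) * (16 * h)) by nra.
  exists (S m), J, h. repeat split; auto; [lia|lra| |].
  - assert (Hr2 : 0 < r ^ 2) by nra.
    assert (r ^ 3 <= 3 / 2 * r ^ 2) by nra.
    assert (HJh : r ^ 2 / 32 <= INR J * h) by lra.
    replace (r ^ 5) with (r ^ 2 * r ^ 3) by ring.
    replace (INR J * h ^ 2) with (INR J * h * h) by ring.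
    assert (r ^ 2 / 32 * h <= INR J * h * h) by nra.
    assert (r ^ 2 * r ^ 3 <= r ^ 2 * (204 * h)) by nra.
    nra.
  - rewrite mult_INR.
    replace (INR (S m) * INR (S m) * r ^ 6) with ((INR (S m) * r ^ 3) ^ 2) by ring.
    nra.
Qed.

(** Each cell contributes at most [exp (- 3 ln n) = n^-3], as [21000 / 7000 = 3], and there are at
    most [50000 / r^6 <= 300000 n^2] cells. *)
Lemma outer_measure_bad_event n r :
  (2 <= n)%nat -> 0 < r -> 1 <= ln (INR n) -> 21000 * ln (INR n) <= INR n * r ^ 5 ->
  outer_measure_le (2 * n) (bad_event n r) (300000 / INR n).
Proof.
  intros Hn Hr Hln Hnr.
  assert (Hn2 : 2 <= INR n) by (apply (le_INR 2) in Hn; simpl in Hn; lra).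
  apply outer_measure_le_of_finite_cover; [lia|].
  destruct (Rlt_le_dec (3 / 2) r) as [Hbig|Hle].
  (* No point of the square is farther than [3 / 4 < r / 2] from the centre, so every vertex is in
     the core. *)
  { exists []. split; [easy|]. split.
    - intros x Hx. exfalso.
      apply bad_event_undominated in Hx; [|lia|lra].
      destruct Hx as [Hx [v [Hv [Hrv _]]]].
      assert (center_dist x v <= 3 / 4); [|lra].
      assert (Hpx : 0 <= ptx x v <= 1) by (apply Hx; lia).
      assert (Hpy : 0 <= pty x v <= 1) by (apply Hx; lia).
      apply nrm_le; nra.
    - simpl. apply Rlt_le, Rdiv_lt_0_compat; lra. }
  destruct (grid_parameters r) as
    [M [J [h [HM [Hh [HMh [HhC [HJ [Hvol HMM]]]]]]]]]; [lra|].
  apply (finite_cover_mono _ _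
    (fun x => exists c, In c (grid M) /\ (in_unit_cube (2 * n) x /\
       exists v, (v < n)%nat /\ in_cell h c (ptx x v) (pty x v) /\
         undominated n r x v)) _
    (INR (length (grid M)) * exp (- (INR n * (INR J * h ^ 2))))).
  - intros x Hx. apply bad_event_undominated in Hx; [|lia|lra].
    destruct Hx as [Hx [v [Hv Hund]]].
    destruct (exists_cell M h (ptx x v) (pty x v)) as [c [Hc Hin]]; auto;
      try (apply Hx; lia).
    exists c. eauto 6.
  - rewrite length_grid.
    assert (Hexp : exp (- (INR n * (INR J * h ^ 2))) <= / INR n ^ 3).
    { replace (/ INR n ^ 3) with (exp (- (3 * ln (INR n)))).
      - destruct (Req_dec (INR n * (INR J * h ^ 2)) (3 * ln (INR n))) as [->|Hne];
          [lra|].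
        apply Rlt_le, exp_increasing.
        assert (INR n * (r ^ 5 / 7000) <= INR n * (INR J * h ^ 2)) by nra. lra.
      - rewrite exp_Ropp. f_equal.
        rewrite <- (exp_ln (INR n)) at 2 by lra.
        rewrite <- Rpower_pow by apply exp_pos. unfold Rpower.
        rewrite ln_exp. f_equal; simpl; ring. }
    assert (Hr5 : 1 <= INR n * r ^ 5) by lra.
    assert (Hr10 : 1 <= INR n ^ 2 * r ^ 10).
    { replace (INR n ^ 2 * r ^ 10) with ((INR n * r ^ 5) ^ 2) by ring. nra. }
    assert (Hr4 : 0 < r ^ 4 <= 6).
    { split; [now apply pow_lt|].
      apply Rle_trans with ((3 / 2) ^ 4); [apply pow_incr; lra|lra]. }
    (* From [n^2 r^10 >= 1] and [r^4 <= 6]: this bounds the number of cells by a multiple of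
       [n^2]. *)
    assert (Hr6 : 1 <= 6 * INR n ^ 2 * r ^ 6).
    { replace (r ^ 10) with (r ^ 4 * r ^ 6) in Hr10 by ring.
      assert (0 < INR n ^ 2 * r ^ 6)
        by (apply Rmult_lt_0_compat; apply pow_lt; lra).
      nra. }
    assert (HMM' : INR (M * M) <= 300000 * INR n ^ 2).
    { pose proof (pos_INR (M * M)).
      assert (INR (M * M) <= INR (M * M) * (6 * INR n ^ 2 * r ^ 6)) by nra.
      assert (0 <= INR n ^ 2) by (apply pow2_ge_0).
      nra. }
    apply Rle_trans with (300000 * INR n ^ 2 * / INR n ^ 3).
    + apply Rmult_le_compat; auto; [apply pos_INR|apply Rlt_le, exp_pos].
    + apply Req_le. field. lra.
  - apply finite_cover_union. intros c Hc.
    apply finite_cover_undominated_in_cell with M; auto.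
Qed.

Theorem theorem5 :
  exists K2 : R, 0 < K2 /\
  forall r : nat -> R,
    (forall n : nat, (2 <= n)%nat ->
       r n >= K2 * Rpower (ln (INR n) / INR n) (1 / 5)) ->
    forall eps : R, 0 < eps ->
      exists N : nat, forall n : nat, (N <= n)%nat ->
        outer_measure_le (2 * n) (bad_event n (r n)) eps.
Proof.
  (* With [10^5 = 100000 >= 21000] the constant [10] meets the requirement on [n r^5]. *)
  exists 10. split; [lra|]. intros r Hr eps Heps.
  destruct (nat_floor (300000 / eps)) as [m [_ Hm]].
  { apply Rlt_le, Rdiv_lt_0_compat; lra. }
  (* The [m] gives [n > 300000 / eps], and the [4] gives [n > 3 >= exp 1], hence [ln n >= 1]. *)
  exists (m + 4)%nat. intros n Hn.
  assert (Hn' : INR m + 4 <= INR n).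
  { apply le_INR in Hn. rewrite plus_INR in Hn. simpl in Hn. lra. }
  pose proof (pos_INR m).
  assert (Hln : 1 <= ln (INR n)).
  { rewrite <- (ln_exp 1). pose proof exp_le_3. pose proof (exp_pos 1).
    apply Rlt_le, ln_increasing; lra. }
  specialize (Hr n ltac:(lia)).
  set (y := ln (INR n) / INR n) in *.
  assert (Hy : 0 < y) by (apply Rdiv_lt_0_compat; lra).
  assert (Hp : 0 < Rpower y (1 / 5)) by apply exp_pos.
  assert (Hp5 : Rpower y (1 / 5) ^ 5 = y).
  { rewrite <- Rpower_pow, Rpower_mult by assumption.
    replace (1 / 5 * INR 5) with 1 by (simpl; field). now apply Rpower_1. }
  assert (Hr5 : 100000 * y <= r n ^ 5).
  { replace (100000 * y) with ((10 * Rpower y (1 / 5)) ^ 5)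
      by (rewrite Rpow_mult_distr, Hp5; ring).
    apply pow_incr. lra. }
  assert (Hyn : INR n * y = ln (INR n)) by (unfold y; field; lra).
  destruct (outer_measure_bad_event n (r n)) as [A [B [H1 [H2 H3]]]];
    [lia|lra|assumption|nra|].
  exists A, B. split; [exact H1|]. split; [exact H2|].
  intros k. apply Rle_trans with (1 := H3 k).
  assert (E : 300000 / eps * eps = 300000) by (field; lra).
  apply Rmult_le_reg_r with (INR n); [lra|].
  replace (300000 / INR n * INR n) with 300000 by (field; lra). nra.
Qed.
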